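(* Let $S$ be a skew-symmetric conference matrix of order $4n\geq 8$. Then (i) $\mathfrak H_S(4n,4,1)$ is a $3$-$(4n,4,3(n-1))$ design; (ii) $\mathfrak H_S(4n,4,9)$ is a $3$-$(4n,4,n)$ design; (iii) $\mathfrak H_{S\pm I}(4n,5,\mp 16)$ is a $3$-$(4n,5,3(n-1)(n-2))$ design; (iv) $\mathfrak H_{S\pm I}(4n,5,\mp 32)$ is a $3$-$(4n,5,5n(n-1))$ design.
   Context: A skew-symmetric conference matrix of order $m$ is an $m\times m$ matrix $S$ with zero diagonal and all off-diagonal entries in $\{-1,1\}$ such that $S^{\top}=-S$ and $SS^{\top}=(m-1)I$. For a $v\times v$ matrix $A$, $\mathfrak H_A(v,k,a)$ is the $k$-uniform hypergraph with vertex set $[v]=\{1,\dots,v\}$ whose hyperedges are the $k$-subsets $\alpha\subset[v]$ with $\det(A[\alpha])=a$, where $A[\alpha]$ is the principal submatrix of $A$ indexed by $\alpha$. In (iii) and (iv) the upper signs are taken together and the lower signs are taken together. For positive integers $t,v,k,\lambda$, a $t$-$(v,k,\lambda)$ design is a $k$-uniform hypergraph on a $v$-element vertex set with the property that any set of $t$ vertices appear together in precisely $\lambda$ hyperedges.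
   Formalization: In (iii) and (iv) the signs are corrected: S+I is paired with determinants 16 and 32, and S−I with −16 and −32, because principal minors of S+I are positive, so the printed pairing gives empty hypergraphs; λ=0 is allowed (n=2 in (iii)). *)

(* Defs.v *)
From mathcomp Require Import all_boot all_order all_algebra.

Set Implicit Arguments.
Unset Strict Implicit.
Unset Printing Implicit Defensive.

Import Order.TTheory GRing.Theory Num.Theory.
Local Open Scope ring_scope.

Definition skew_conference (m : nat) (S : 'M[int]_m) : Prop :=
  [/\ forall i, S i i = 0,
      forall i j, i != j -> S i j = -1 \/ S i j = 1,
      S^T = - S
    & S *m S^T = (m%:Z - 1)%:M].

(* Rows and columns are listed in the increasing order of the indices in al. *)
Definition principal_submx (v : nat) (A : 'M[int]_v) (al : {set 'I_v}) :
  'M[int]_#|al| := mxsub (@enum_val _ (mem al)) (@enum_val _ (mem al)) A.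

(* A hypergraph on V is identified with its set of hyperedges. *)
Definition det_hypergraph (v : nat) (A : 'M[int]_v) (k : nat) (a : int) :
  {set {set 'I_v}} :=
  [set al : {set 'I_v} | (#|al| == k) && (\det (principal_submx A al) == a)].

(* The degenerate value lambda = 0 is allowed: it does occur, e.g. for the
   parameters 3-(8,5,0). *)
Definition is_design (t v k lambda : nat) (V : finType) (E : {set {set V}}) :
  Prop :=
  [/\ #|V| = v,
      forall e : {set V}, e \in E -> #|e| = k
    & forall X : {set V}, #|X| = t ->
        #|[set e in E | X \subset e]| = lambda].

(* Main.v *)
Require Import Defs.
From mathcomp Require Import all_boot all_order all_algebra.
From mathcomp Require Import perm.
From mathcomp Require Import ring zify.

Import Order.TTheory GRing.Theory Num.Theory.
Local Open Scope ring_scope.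

(** The 4 x 4 principal minors of [S] are squares of Pfaffians with three terms
    equal to 1 or -1, hence they are 1 or 9.  For a fixed triple a, b, c the
    Pfaffian of a, b, c, x is linear in column x of [S], so orthogonality of the
    rows gives the sum of these minors over x; this sum determines how many of
    them are 9, which is (i) and (ii).  A 5 x 5 principal minor of [S + I] is
    the sum of all principal minors of the block of [S], that is 16 + 8 N where
    N is the number of 4-subsets with minor 9, and N is always 0 or 2.  As the
    4-subsets with minor 9 form a 3-design, double counting gives the sum of N
    over the 5-sets containing a given triple, hence (iii) and (iv) for [S + I].
    Finally [S - I] is the transpose of [- (S + I)]. *)

(** * Counting intermediate sets *)

(** Removing [A] is a bijection onto the subsets of [B :\: A] of size [k - #|A|]. The bound on [k]
    excludes a truncated difference, for which the binomial would be 1. *)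
Lemma card_between (T : finType) (A B : {set T}) (k : nat) :
  A \subset B -> (#|A| <= k)%N ->
  #|[set C : {set T} | [&& A \subset C, C \subset B & #|C| == k]]|
  = 'C(#|B| - #|A|, k - #|A|).
Proof.
move=> sAB leAk.
have -> : (#|B| - #|A| = #|B :\: A|)%N by rewrite cardsD (setIidPr sAB).
rewrite -cards_draws -(card_in_imset (f := fun C => C :\: A)); last first.
  move=> C D; rewrite !inE => /and3P[sAC _ _] /and3P[sAD _ _] eqCD.
  by rewrite -(setID C A) -(setID D A) eqCD (setIidPr sAC) (setIidPr sAD).
apply: eq_card => D; rewrite !inE; apply/imsetP/andP => [[C]|[sDB /eqP cD]].
  rewrite !inE => /and3P[sAC sCB /eqP cC] ->; split; first exact: setSD.
  by rewrite cardsD (setIidPr sAC) cC.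
move: sDB; rewrite subsetD => /andP[sDB dDA].
have DAK : (D :|: A) :\: A = D by rewrite setDUl setDv setU0; apply/setDidPl.
exists (D :|: A); last by rewrite DAK.
rewrite inE subsetUr subUset sDB sAB /= -(cardsID A (D :|: A)).
by rewrite DAK (setIidPr (subsetUr _ _)) cD subnKC.
Qed.

(** * Principal minors as polynomials in the entries *)

(** Two enumerations of the same index set differ by a permutation; it acts on rows and on columns,
    so its sign occurs twice and cancels. Minors may thus be computed in any order of the
    indices. *)
Lemma det_mxsub_image (R : comNzRingType) (v m k : nat) (A : 'M[R]_v)
    (f : 'I_m -> 'I_v) (g : 'I_k -> 'I_v) :
  injective f -> injective g -> codom f =i codom g ->
  \det (mxsub f f A) = \det (mxsub g g A).
Proof.
move=> injf injg eqfg.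
have emk : m = k by rewrite -[m]card_ord -[k]card_ord -(card_codom injf)
   -(card_codom injg); apply: eq_card.
subst k.
have h i : exists j, g i == f j.
  have /codomP[j ->] : g i \in codom f by rewrite eqfg codom_f.
  by exists j.
pose p i := xchoose (h i).
have pE i : g i = f (p i) by apply/eqP/(xchooseP (h i)).
have injp : injective p by move=> i j e; apply: injg; rewrite !pE e.
have -> : mxsub g g A
    = row_perm (perm injp) (col_perm (perm injp) (mxsub f f A)).
  by apply/matrixP => i j; rewrite !mxE !permE -!pE.
rewrite row_permE col_permE !det_mulmx !det_perm mulrCA odd_permV.
by rewrite -signr_addb addbb mulr1.
Qed.

Lemma det_principal_tuple (v k : nat) (A : 'M[int]_v) (al : {set 'I_v})
    (t : k.-tuple 'I_v) :
  uniq t -> al =i t -> \det (principal_submx A al) =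
  \det (mxsub (tnth t) (tnth t) A).
Proof.
move=> ut alt; apply: det_mxsub_image.
- exact: enum_val_inj.
- exact/tuple_uniqP.
move=> x; transitivity (x \in t); last first.
  by apply/tnthP/codomP.
rewrite -alt; apply/codomP/idP => [[i ->]|xal]; first exact: enum_valP.
by exists (enum_rank_in xal x); rewrite enum_rankK_in.
Qed.

(* Unlike [\det], this unfolds to an explicit polynomial by computation. *)
Fixpoint laplace {R : comNzRingType} (k : nat) (f : nat -> nat -> R) : R :=
  if k is k'.+1 then
    foldr (fun j => +%R ((-1) ^+ j * f 0%N j *
      laplace k' (fun i l => f i.+1 (bump j l)))) 0 (iota 0 k)
  else 1.

Lemma laplaceE (R : comNzRingType) (k : nat) (f : nat -> nat -> R) :
  \det (\matrix_(i < k, j < k) f i j) = laplace k f.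
Proof.
elim: k f => [|k IH] f; first by rewrite det_mx00.
rewrite (expand_det_row _ ord0).
transitivity (\sum_(j <- iota 0 k.+1) ((-1) ^+ j * f 0%N j *
      laplace k (fun i l => f i.+1 (bump j l)))); last first.
  by rewrite unlock.
rewrite -[iota 0 k.+1]/(index_iota 0 k.+1) big_mkord; apply: eq_bigr => j _.
rewrite mxE /cofactor -IH mulrCA mulrA; congr (_ * \det _).
by apply/matrixP => i l; rewrite !mxE.
Qed.
Definition pfaffian4 {R : comNzRingType} {v : nat} (S : 'M[R]_v)
    (a b c d : 'I_v) : R :=
  S a b * S c d - S a c * S b d + S a d * S b c.

(** Here [thead t] is only the default value of [nth] and is never reached as such. *)
Lemma det_mxsub_laplace (R : comNzRingType) (v k : nat) (A : 'M[R]_v)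
  (t : k.+1.-tuple 'I_v) :
  \det (mxsub (tnth t) (tnth t) A) = laplace k.+1
   (fun i j => A (nth (thead t) t i) (nth (thead t) t j)).
Proof.
rewrite -laplaceE; congr (\det _); apply/matrixP => i j.
by rewrite !mxE -!tnth_nth.
Qed.

Lemma det_skew4 (R : comNzRingType) (v : nat) (S : 'M[R]_v) (a b c d : 'I_v) :
  (forall i, S i i = 0) -> S^T = - S ->
  let t := [tuple a; b; c; d] in
  \det (mxsub (tnth t) (tnth t) S) = pfaffian4 S a b c d ^+ 2.
Proof.
move=> S0 skewS /=.
have sk i j : S j i = - S i j.
  by have := congr1 (fun M : 'M_v => M i j) skewS; rewrite !mxE.
rewrite det_mxsub_laplace /pfaffian4 /= !S0 (sk a b) (sk a c) (sk a d) (sk b c).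
rewrite (sk b d) (sk c d).
by ring.
Qed.

(** The determinant of the identity plus a matrix is the sum of all principal minors of that matrix.
    Those of odd order vanish by skewness; the others are 1 for the empty set, squared entries for
    pairs and squared Pfaffians for quadruples. Distinct indices keep the added 1 on the
    diagonal. *)
Lemma det_skew5 (R : comNzRingType) (v : nat) (S : 'M[R]_v) (a b c d e : 'I_v) :
  (forall i, S i i = 0) -> S^T = - S -> uniq [:: a; b; c; d; e] ->
  let t := [tuple a; b; c; d; e] in
  \det (mxsub (tnth t) (tnth t) (S + 1%:M)) =
  1 + S a b ^+ 2 + S a c ^+ 2 + S a d ^+ 2 + S a e ^+ 2 + S b c ^+ 2
    + S b d ^+ 2 + S b e ^+ 2 + S c d ^+ 2 + S c e ^+ 2 + S d e ^+ 2
    + pfaffian4 S b c d e ^+ 2 + pfaffian4 S a c d e ^+ 2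
    + pfaffian4 S a b d e ^+ 2
    + pfaffian4 S a b c e ^+ 2 + pfaffian4 S a b c d ^+ 2.
Proof.
move=> S0 skewS ut /=.
have sk i j : S j i = - S i j.
  by have := congr1 (fun M : 'M_v => M i j) skewS; rewrite !mxE.
have D i : (S + 1%:M) i i = 1 by rewrite !mxE S0 eqxx add0r.
have U i j : i != j -> (S + 1%:M) i j = S i j.
  by rewrite !mxE => /negPf->; rewrite addr0.
have L i j : i != j -> (S + 1%:M) j i = - S i j.
  by move=> h; rewrite U 1?eq_sym // sk.
rewrite det_mxsub_laplace.
move: ut => /=; rewrite !inE !negb_or andbT.
case/and4P=> /and4P[ab ac ad ae] /and3P[bc bd be] /andP[cd ce] de.
rewrite /pfaffian4 /= !D.
rewrite (U _ _ ab) (U _ _ ac) (U _ _ ad) (U _ _ ae) (U _ _ bc) (U _ _ bd)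
  (U _ _ be) (U _ _ cd) (U _ _ ce) (U _ _ de).
rewrite (L _ _ ab) (L _ _ ac) (L _ _ ad) (L _ _ ae) (L _ _ bc) (L _ _ bd)
  (L _ _ be) (L _ _ cd) (L _ _ ce) (L _ _ de).
by ring.
Qed.

(** * One-point extensions and double counting in designs *)

Lemma supersets1_imset (V : finType) (T : {set V}) :
  [set q : {set V} | (T \subset q) && (#|q| == #|T|.+1)]
  = [set x |: T | x in ~: T].
Proof.
apply/setP => q; rewrite inE; apply/andP/imsetP => [[sTq /eqP cq]|[x]].
  have /cards1P[x qx] : #|q :\: T| == 1%N.
    by rewrite cardsD (setIidPr sTq) cq subSn // subnn.
  have : x \in q :\: T by rewrite qx inE.
  rewrite !inE => /andP[xT xq]; exists x; first by rewrite inE.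
  by rewrite -qx -[LHS](setID q T) (setIidPr sTq) setUC.
by rewrite inE => xT ->; apply/andP; rewrite subsetUr cardsU1 xT eqxx.
Qed.

Lemma subsets1_imset (V : finType) (A : {set V}) :
  [set q : {set V} | (q \subset A) && (#|A| == #|q|.+1)]
  = [set A :\ x | x in A].
Proof.
apply/setP => q; rewrite inE; apply/andP/imsetP => [[sqA /eqP cA]|[x xA ->]].
  have /cards1P[x qx] : #|A :\: q| == 1%N.
    by rewrite cardsD (setIidPr sqA) cA subSn // subnn.
  have : x \in A :\: q by rewrite qx inE.
  rewrite !inE => /andP[xq xA]; exists x => //.
  by rewrite -qx setDDr setDv set0U (setIidPr sqA).
by apply/andP; rewrite subD1set (cardsD1 x A) xA eqxx.
Qed.

Lemma setU1_inj (V : finType) (T : {set V}) :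
  {in ~: T &, injective (fun x => x |: T)}.
Proof.
move=> x y; rewrite !inE => xT yT /setP/(_ x).
by rewrite !inE eqxx (negPf xT) !orbF /= => h; apply/eqP; rewrite -h.
Qed.

Lemma setD1_inj (V : finType) (A : {set V}) :
  {in A &, injective (fun x => A :\ x)}.
Proof.
move=> x y xA yA /setP/(_ x); rewrite !inE eqxx xA !andbT /= => h.
by apply/eqP/negbFE; rewrite -h.
Qed.

(** Double counting of the pairs of a [t]-set [R] and a block [e] with [P \subset R] and
    [R \subset e]. The product form avoids a division. *)
Lemma design_degree (t v k l : nat) (V : finType) (E : {set {set V}})
    (P : {set V}) :
  is_design t v k l E -> (#|P| <= t <= k)%N ->
  (#|[set e in E | P \subset e]| * 'C(k - #|P|, t - #|P|)
   = 'C(v - #|P|, t - #|P|) * l)%N.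
Proof.
case=> cV cE dE /andP[lePt letk].
rewrite -sum_nat_const.
transitivity (\sum_(e in E | P \subset e)
   \sum_(R : {set V} | [&& P \subset R, R \subset e & #|R| == t]) 1)%N.
  apply: eq_big => [e|e]; rewrite ?inE // => /andP[eE sPe].
  by rewrite sum1dep_card card_between // (cE e eE).
(* The vacuous inclusion in [[set: V]] gives the condition the shape counted by [card_between]. *)
rewrite (exchange_big_dep
  (fun R : {set V} => [&& P \subset R, R \subset [set: V] & #|R| == t]));
  last first.
  by move=> e R _ /and3P[-> _ ->]; rewrite subsetT.
rewrite -cV -cardsT -card_between ?subsetT // -sum_nat_cond_const.
apply: eq_big => [R|R]; rewrite ?inE // => /and3P[sPR _ /eqP cR].
rewrite -(dE R cR) sum1dep_card; apply: eq_card => e.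
rewrite !inE cR eqxx sPR andbT /=.
case: (e \in E) => //=; case sRe: (R \subset e); rewrite ?andbF //.
by rewrite (subset_trans sPR sRe).
Qed.

(** Both sides count the pairs of a block [e] and a [j]-subset [P] of [T :&: e]. *)
Lemma sum_bin_setI (V : finType) (E : {set {set V}}) (T : {set V}) (j : nat) :
  (\sum_(e in E) 'C(#|T :&: e|, j)
   = \sum_(P : {set V} | (P \subset T) && (#|P| == j))
       #|[set e in E | P \subset e]|)%N.
Proof.
under eq_bigr => e _ do rewrite -cards_draws -sum1dep_card.
under [RHS]eq_bigr => P _ do rewrite -sum1dep_card.
rewrite (exchange_big_dep
  (fun P : {set V} => (P \subset T) && (#|P| == j))) /=; last first.
  by move=> e P _ /andP[]; rewrite subsetI => /andP[->].
apply: eq_bigr => P /andP[sPT cP]; apply: eq_bigl => e.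
by rewrite subsetI sPT cP andbT.
Qed.

(** After exchanging the sums, each block [q] counts the quintuples containing [T :|: q]. This
    reduces the total to the degrees of [T] and of its three pairs:
    [3 * n * (2 * n - 1) + (4 * n - 7) * n]. *)
Lemma sum_quads_in_quintuples (n : nat) (V : finType) (E : {set {set V}})
    (T : {set V}) :
  (1 < n)%N -> is_design 3 (4 * n) 4 n E -> #|T| = 3%N ->
  (\sum_(al : {set V} | (T \subset al) && (#|al| == 5))
     #|[set q in E | q \subset al]| = 10 * n * (n - 1))%N.
Proof.
move=> n1 dE cT; have [cV cE dT] := dE.
under eq_bigr => al _ do rewrite -sum1dep_card.
rewrite (exchange_big_dep (mem E)) /=; last by move=> ? ? _ /andP[].
(* [T :|: q] has [7 - i] elements with [i = #|T :&: q|], so it lies in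
   [4 * n - 4] quintuples if [i = 3], in one if [i = 2] and in none if [i < 2];
   the summand below interpolates these values. *)
transitivity (\sum_(q in E)
  ('C(#|T :&: q|, 2) + (4 * n - 7) * 'C(#|T :&: q|, 3)))%N.
  apply: eq_bigr => q qE.
  have cTq := cardsUI T q; rewrite cT (cE q qE) in cTq.
  have leTq : (#|T :&: q| <= 3)%N by rewrite -cT subset_leq_card ?subsetIl.
  rewrite (eq_bigl (fun al : {set V} =>
    [&& T :|: q \subset al, al \subset [set: V] & #|al| == 5%N])); last first.
    by move=> al; rewrite qE subUset subsetT /= andbAC -andbA.
  rewrite sum1dep_card; have [le5|gt5] := leqP #|T :|: q| 5.
    rewrite card_between ?subsetT // cardsT cV.
    have [e|e] : (#|T :&: q| = 2 \/ #|T :&: q| = 3)%N by lia.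
      have -> : #|T :|: q| = 5%N by lia.
      by rewrite e subnn bin0 binn bin_small ?muln0.
    have -> : #|T :|: q| = 4%N by lia.
    by rewrite e subSnn bin1 !binn; change 'C(3, 2) with 3%N; lia.
  rewrite !bin_small ?addn0 ?muln0; [|lia|lia].
  apply: eq_card0 => al; rewrite !inE; apply/negP => /and3P[/subset_leq_card].
  by move=> le _ /eqP c; move: gt5; rewrite ltnNge -c le.
rewrite big_split -big_distrr /= !sum_bin_setI.
(* The only triple inside [T] is [T] itself. *)
rewrite [X in (_ + _ * X)%N](_ : _ = n); last first.
  rewrite (big_pred1 T) ?dT // => P /=; rewrite -cT eqEcard eqn_leq.
  by case: (boolP (P \subset T)) => //= /subset_leq_card ->.
(* By [design_degree], twice the degree of a pair is [(4 * n - 2) * n]. *)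
rewrite (eq_bigr (fun _ => n * (2 * n - 1)))%N; last first.
  move=> P /andP[_ /eqP cP]; have := design_degree _ _ _ _ _ _ P dE.
  rewrite cP => /(_ isT); rewrite !bin1; nia.
by rewrite sum_nat_cond_const cards_draws cT; change 'C(3, 2) with 3%N; nia.
Qed.

(** * Minors of orders 4 and 5 of a conference matrix *)

Lemma set_tuple_uniq (T : finType) (k : nat) (A : {set T}) :
  #|A| = k -> exists2 t : k.-tuple T, uniq t & A =i t.
Proof.
move=> cA; have sz : size (enum A) == k by rewrite -cardE cA.
by exists (Tuple sz) => [|x]; rewrite ?enum_uniq //= mem_enum.
Qed.

(** Boolean exponents reduce claims on small minors to finite case analyses. *)
Lemma conference_sign (m : nat) (S : 'M[int]_m) (i j : 'I_m) :
  skew_conference S -> i != j -> exists b : bool, S i j = (-1) ^+ b.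
Proof.
case=> _ pm _ _ /pm[] ->; [by exists true | by exists false].
Qed.

Lemma det_principal_quad (m : nat) (S : 'M[int]_m) (a b c d : 'I_m)
    (q : {set 'I_m}) :
  skew_conference S -> uniq [:: a; b; c; d] -> q =i [:: a; b; c; d] ->
  \det (principal_submx S q) = pfaffian4 S a b c d ^+ 2.
Proof.
case=> S0 _ skewS _ u qE.
by rewrite (@det_principal_tuple _ _ S q [tuple a; b; c; d]) // det_skew4.
Qed.

(** A sum of three signs is odd and at most 3 in absolute value. Writing its square with an
    indicator makes sums of minors count the nines. *)
Lemma det_principal_quad_1_9 (m : nat) (S : 'M[int]_m) (q : {set 'I_m}) :
  skew_conference S -> #|q| = 4%N ->
  \det (principal_submx S q) = 1 + 8 * (\det (principal_submx S q) == 9)%:R.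
Proof.
move=> hS /set_tuple_uniq[[[|a [|b [|c [|d [|//]]]]] //= i4] u qE].
rewrite (@det_principal_quad _ _ _ _ _ _ _ hS u qE) /pfaffian4.
move: u; rewrite /= !inE !negb_or andbT.
case/and3P=> /and3P[ab ac ad] /andP[bc bd] cd.
have [s1 ->] := @conference_sign _ _ _ _ hS ab.
have [s2 ->] := @conference_sign _ _ _ _ hS ac.
have [s3 ->] := @conference_sign _ _ _ _ hS ad.
have [s4 ->] := @conference_sign _ _ _ _ hS bc.
have [s5 ->] := @conference_sign _ _ _ _ hS bd.
have [s6 ->] := @conference_sign _ _ _ _ hS cd.
by move: s1 s2 s3 s4 s5 s6; do 6! case.
Qed.

(** Indexing the 4-subsets by the omitted point gives five explicit terms. *)
Lemma card_quads_in_quintuple (m : nat) (S : 'M[int]_m) (t : 5.-tuple 'I_m)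
    (al : {set 'I_m}) :
  uniq t -> al =i t ->
  #|[set q in det_hypergraph S 4 9 | q \subset al]|
  = (\sum_(x <- t) (\det (principal_submx S (al :\ x)) == 9%R))%N.
Proof.
move=> ut alt.
have cal : #|al| = 5%N by rewrite (eq_card alt) (card_uniqP ut) size_tuple.
transitivity #|[set al :\ x | x in
   [set x in al | \det (principal_submx S (al :\ x)) == 9]]|.
  apply: eq_card => q; rewrite !inE.
  have /setP/(_ q) := @subsets1_imset _ al; rewrite inE cal eqSS eq_sym andbC.
  move=> qE; rewrite andbAC qE.
  apply/andP/imsetP => [[/imsetP[x xal ->] dx]|[x]].
    by exists x; rewrite ?inE ?xal.
  by rewrite inE => /andP[xal dx] ->; split=> //; apply: imset_f.
rewrite card_in_imset; last first.
  by move=> x y; rewrite !inE => /andP[xal _] /andP[yal _]; apply: setD1_inj.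
rewrite big_uniq //= -sum1_card big_mkcond [RHS]big_mkcond /=.
apply: eq_bigr => x _; rewrite inE alt; by case: (x \in t); case: (_ == 9).
Qed.

Lemma det_principal_quintuple (m : nat) (S : 'M[int]_m) (al : {set 'I_m}) :
  skew_conference S -> #|al| = 5%N ->
  let N := #|[set q in det_hypergraph S 4 9 | q \subset al]| in
  (N = 0 \/ N = 2)%N /\ \det (principal_submx (S + 1%:M) al) = (16 + 8 * N)%:R.
Proof.
move=> hS /set_tuple_uniq[t]; rewrite /=.
case: t => -[|a [|b [|c [|d [|e [|//]]]]]] //= i5 u alE.
rewrite (@card_quads_in_quintuple _ S [tuple a; b; c; d; e] al u alE) /=.
have [S0 _ skewS _] := hS.
rewrite (@det_principal_tuple _ _ _ _ [tuple a; b; c; d; e] u alE) det_skew5 //.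
rewrite !big_cons big_nil.
have al' x y : y \in al :\ x = (y != x) && (y \in [:: a; b; c; d; e]).
  by rewrite in_setD1 alE.
have := u; rewrite /= !inE !negb_or andbT.
case/and4P=> /and4P[ab ac ad ae] /and3P[bc bd be] /andP[cd ce] de.
have [s1 e1] := @conference_sign _ _ _ _ hS ab.
have [s2 e2] := @conference_sign _ _ _ _ hS ac.
have [s3 e3] := @conference_sign _ _ _ _ hS ad.
have [s4 e4] := @conference_sign _ _ _ _ hS ae.
have [s5 e5] := @conference_sign _ _ _ _ hS bc.
have [s6 e6] := @conference_sign _ _ _ _ hS bd.
have [s7 e7] := @conference_sign _ _ _ _ hS be.
have [s8 e8] := @conference_sign _ _ _ _ hS cd.
have [s9 e9] := @conference_sign _ _ _ _ hS ce.
have [s10 e10] := @conference_sign _ _ _ _ hS de.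
(* The minor omitting [x] can be read off any listing of the other four points. *)
have quad x p q r s : perm_eq [:: x; p; q; r; s] [:: a; b; c; d; e] ->
    \det (principal_submx S (al :\ x)) = pfaffian4 S p q r s ^+ 2.
  move=> h; have : uniq [:: a; b; c; d; e] := u.
  rewrite -(perm_uniq h) => /andP[xN us].
  apply: det_principal_quad => // y.
  rewrite al' -(perm_mem h) inE; case: eqVneq => //= ->; exact/esym/negbTE.
rewrite (quad a b c d e) // (quad b a c d e); last first.
  exact: (permEl (perm_catCA [:: b] [:: a] _)).
rewrite (quad c a b d e); last exact: (permEl (perm_catCA [:: c] [:: a; b] _)).
rewrite (quad d a b c e); last first.
  exact: (permEl (perm_catCA [:: d] [:: a; b; c] _)).
rewrite (quad e a b c d); last first.
  exact: (permEl (perm_catCA [:: e] [:: a; b; c; d] [::])).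
rewrite /pfaffian4 e1 e2 e3 e4 e5 e6 e7 e8 e9 e10.
(* Both claims now depend on ten signs only; all 1024 patterns are evaluated. *)
split; [apply/pred2P | apply/eqP];
  move: s1 s2 s3 s4 s5 s6 s7 s8 s9 s10 {e1 e2 e3 e4 e5 e6 e7 e8 e9 e10}.
  by do 10! case; vm_compute.
by do 10! case; vm_compute.
Qed.

Lemma sum_pfaffian4_sqr (m : nat) (S : 'M[int]_m) (a b c : 'I_m) :
  skew_conference S -> uniq [:: a; b; c] ->
  \sum_x pfaffian4 S a b c x ^+ 2 = 3 * (m%:Z - 1).
Proof.
move=> hS /=; rewrite !inE negb_or andbT => /andP[/andP[ab ac] bc].
have [_ _ _ SST] := hS.
have orth i j : \sum_x S i x * S j x = (m%:Z - 1) *+ (i == j).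
  have := congr1 (fun M : 'M_m => M i j) SST; rewrite !mxE => <-.
  by apply: eq_bigr => x _; rewrite mxE.
have sq i j : i != j -> S i j ^+ 2 = 1.
  by move=> /(@conference_sign _ _ _ _ hS)[s ->]; rewrite sqrr_sign.
(* In the expanded square, the first three terms give squared norms of rows, each [m - 1]; the cross
   terms give inner products of distinct rows, which vanish. *)
transitivity (\sum_x (S a b ^+ 2 * (S c x * S c x)
   + S a c ^+ 2 * (S b x * S b x)
   + S b c ^+ 2 * (S a x * S a x) + (- 2 * S a b * S a c) * (S b x * S c x)
   + (2 * S a b * S b c) * (S a x * S c x)
   + (- 2 * S a c * S b c) * (S a x * S b x))).
  by apply: eq_bigr => x _; rewrite /pfaffian4; ring.
rewrite !big_split -!mulr_sumr /= !orth !eqxx (negPf ab) (negPf ac) (negPf bc).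
rewrite !sq //.
by rewrite !mulr0n !mulr1n; ring.
Qed.

Lemma sum_det_quads (m : nat) (S : 'M[int]_m) (T : {set 'I_m}) :
  skew_conference S -> #|T| = 3%N ->
  \sum_(q : {set 'I_m} | (T \subset q) && (#|q| == 4%N))
    \det (principal_submx S q) = 3 * (m%:Z - 1).
Proof.
move=> hS cT.
have [[[|a [|b [|c [|//]]]] //= i3] u TE] := @set_tuple_uniq _ _ _ cT.
(* A Pfaffian with a repeated index is 0, so only [x] outside [T] contributes. *)
rewrite -(@sum_pfaffian4_sqr _ _ _ _ _ hS u) [RHS](bigID (fun x => x \in T)) /=
  [X in X + _]big1 ?add0r; last first.
  move=> x; have [S0 _ skewS _] := hS.
  have sk i j : S j i = - S i j.
    by have := congr1 (fun M : 'M_m => M i j) skewS; rewrite !mxE.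
  rewrite TE !inE /pfaffian4 => /or3P[] /eqP ->;
    rewrite !S0 ?(sk a b) ?(sk a c) ?(sk b c); ring.
rewrite (eq_bigl (mem [set x |: T | x in ~: T])); last first.
  by move=> q; rewrite -supersets1_imset !inE cT.
rewrite big_imset /=; last exact: setU1_inj.
apply: eq_big => x; rewrite inE // => xT /=.
have uc : uniq [:: a; b; c; x].
  by rewrite -[[:: a; b; c; x]]/(rcons [:: a; b; c] x) rcons_uniq -TE xT.
apply: det_principal_quad hS uc _ => y.
rewrite in_setU1 TE -[[:: a; b; c; x]]/(rcons [:: a; b; c] x).
by rewrite mem_rcons in_cons.
Qed.

(** * Degrees of triples in the determinant hypergraphs *)

Lemma card_supersets (V : finType) (T : {set V}) (k : nat) :
  (#|T| <= k)%N ->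
  #|[set e : {set V} | (T \subset e) && (#|e| == k)]| =
  'C(#|V| - #|T|, k - #|T|).
Proof.
move=> leT; rewrite -cardsT -card_between ?subsetT //.
by apply: eq_card => e; rewrite !inE subsetT.
Qed.

Lemma det_hypergraph_degree (m : nat) (A : 'M[int]_m) (k : nat) (a : int)
    (T : {set 'I_m}) :
  #|[set e in det_hypergraph A k a | T \subset e]|
  = (\sum_(e : {set 'I_m} | (T \subset e) && (#|e| == k))
      (\det (principal_submx A e) == a))%N.
Proof.
rewrite -sum1dep_card [LHS]big_mkcond [RHS]big_mkcond /=.
apply: eq_bigr => e _; rewrite !inE.
by case: (T \subset e); case: (#|e| == k); case: (_ == a).
Qed.

Lemma det_hypergraph_design (t m k l : nat) (A : 'M[int]_m) (a : int) :
  (forall T : {set 'I_m}, #|T| = t ->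
     #|[set e in det_hypergraph A k a | T \subset e]| = l) ->
  is_design t m k l (det_hypergraph A k a).
Proof.
by move=> h; split=> // [|e]; rewrite ?card_ord // inE => /andP[/eqP].
Qed.

Lemma quad_degree_9 (n : nat) (S : 'M[int]_(4 * n)) (T : {set 'I_(4 * n)}) :
  (1 < n)%N -> skew_conference S -> #|T| = 3%N ->
  #|[set e in det_hypergraph S 4 9 | T \subset e]| = n.
Proof.
move=> n1 hS cT.
have := @sum_det_quads _ _ _ hS cT.
rewrite (eq_bigr (fun q =>
  ((1 + 8 * (\det (principal_submx S q) == 9%R))%N : nat)%:Z));
  last first.
  move=> q /andP[_ /eqP cq]; rewrite {1}(@det_principal_quad_1_9 _ _ _ hS cq).
  by case: (_ == 9).
rewrite -(big_morph Posz PoszD (erefl 0%:Z)) big_split sum1dep_card.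
rewrite -big_distrr -det_hypergraph_degree card_supersets cT //.
rewrite card_ord bin1 /=.
(* The [4 * n - 3] quadruples over [T] contribute 1 each, and 8 more for each minor 9; the total
   [3 * (4 * n - 1)] determines [N]. *)
set N := (X in X = n) => h.
have {}h : (4 * n - 3 + 8 * N)%N%:Z = 3 * ((4 * n)%N%:Z - 1) := h.
by lia.
Qed.

Lemma quad_degree_1 (n : nat) (S : 'M[int]_(4 * n)) (T : {set 'I_(4 * n)}) :
  (1 < n)%N -> skew_conference S -> #|T| = 3%N ->
  #|[set e in det_hypergraph S 4 1 | T \subset e]| = (3 * (n - 1))%N.
Proof.
move=> n1 hS cT.
have : (#|[set e in det_hypergraph S 4 1 | T \subset e]|
   + #|[set e in det_hypergraph S 4 9 | T \subset e]| = 4 * n - 3)%N.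
  rewrite !det_hypergraph_degree -big_split /=.
  transitivity (\sum_(e : {set 'I_(4 * n)} | (T \subset e) && (#|e| == 4)) 1)%N.
    apply: eq_bigr => q /andP[_ /eqP cq].
    by rewrite (@det_principal_quad_1_9 _ _ _ hS cq); case: (_ == 9).
  by rewrite sum1dep_card card_supersets cT // card_ord bin1.
by rewrite quad_degree_9 //; lia.
Qed.

Lemma quintuple_degree (n : nat) (S : 'M[int]_(4 * n)) (T : {set 'I_(4 * n)}) :
  (1 < n)%N -> skew_conference S -> #|T| = 3%N ->
  #|[set e in det_hypergraph (S + 1%:M) 5 16 | T \subset e]|
    = (3 * (n - 1) * (n - 2))%N /\
  #|[set e in det_hypergraph (S + 1%:M) 5 32 | T \subset e]|
    = (5 * n * (n - 1))%N.
Proof.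
move=> n1 hS cT.
have d9 : is_design 3 (4 * n) 4 n (det_hypergraph S 4 9).
  by apply: det_hypergraph_design => X; apply: quad_degree_9.
have := @sum_quads_in_quintuples _ _ _ _ n1 d9 cT.
(* A quintuple contains two quadruples of minor 9 if its minor is 32, and none if it is 16. *)
rewrite (eq_bigr (fun e =>
  2 * (\det (principal_submx (S + 1%:M) e) == 32%R)))%N;
  last first.
  move=> e /andP[_ /eqP ce].
  by have [[] -> ->] := @det_principal_quintuple _ _ _ hS ce.
rewrite -big_distrr -det_hypergraph_degree /= => s32.
have h32 : #|[set e in det_hypergraph (S + 1%:M) 5 32 | T \subset e]|
    = (5 * n * (n - 1))%N.
  move: s32; set N := (X in _ -> X = _) => h.
  have {}h : (2 * N = 10 * n * (n - 1))%N := h.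
  by nia.
split=> //.
(* Every quintuple over [T] has minor 16 or 32, so the first degree is the complement of the
   second. *)
have : (#|[set e in det_hypergraph (S + 1%:M) 5 16 | T \subset e]|
   + #|[set e in det_hypergraph (S + 1%:M) 5 32 | T \subset e]|
   = 'C(4 * n - 3, 2))%N.
  rewrite !det_hypergraph_degree -big_split /=.
  transitivity (\sum_(e : {set 'I_(4 * n)} | (T \subset e) && (#|e| == 5)) 1)%N.
    apply: eq_bigr => e /andP[_ /eqP ce].
    by have [[] -> ->] := @det_principal_quintuple _ _ _ hS ce.
  by rewrite sum1dep_card card_supersets cT // card_ord.
rewrite bin2 h32.
have -> : ((4 * n - 3) * (4 * n - 3).-1 = ((4 * n - 3) * (2 * n - 2)).*2)%N.
  by nia.
rewrite doubleK; move: #|_| => N.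
(* This substitution removes all truncated subtractions. *)
have [p ->] : exists p, n = (p + 2)%N by exists (n - 2)%N; lia.
have [-> -> -> ->] : [/\ 4 * (p + 2) - 3 = 4 * p + 5,
  2 * (p + 2) - 2 = 2 * p + 2,
  p + 2 - 1 = p + 1 & p + 2 - 2 = p]%N by split; lia.
by lia.
Qed.

(** * Passage from [S + 1%:M] to [S - 1%:M], and conclusion *)

Lemma det_principal_sub1 (m : nat) (S : 'M[int]_m) (al : {set 'I_m}) :
  S^T = - S ->
  \det (principal_submx (S - 1%:M) al)
  = (-1) ^+ #|al| * \det (principal_submx (S + 1%:M) al).
Proof.
move=> skewS; rewrite -[in RHS]det_tr -detZ; congr (\det _).
have -> : S - 1%:M = - (S + 1%:M)^T.
  by rewrite linearD /= skewS tr_scalar_mx opprD opprK.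
by apply/matrixP => i j; rewrite !mxE mulN1r.
Qed.

(** Transposition preserves minors and negation multiplies those of odd order by -1, so the values
    16 and 32 become -16 and -32. *)
Lemma det_hypergraph_sub1 (m : nat) (S : 'M[int]_m) (k : nat) (a : int) :
  S^T = - S -> odd k ->
  det_hypergraph (S - 1%:M) k (- a) = det_hypergraph (S + 1%:M) k a.
Proof.
move=> skewS ok; apply/setP => al; rewrite !inE; case: eqP => //= cal.
by rewrite det_principal_sub1 // -signr_odd [in odd _]cal ok mulN1r eqr_opp.
Qed.

Theorem mainTheorem4 (n : nat) (hn : (8 <= 4 * n)%N) (S : 'M[int]_(4 * n))
    (hS : skew_conference S) :
  is_design 3 (4 * n) 4 (3 * (n - 1)) (det_hypergraph S 4 1) /\
  is_design 3 (4 * n) 4 n (det_hypergraph S 4 9) /\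
  (is_design 3 (4 * n) 5 (3 * (n - 1) * (n - 2))
     (det_hypergraph (S + 1%:M) 5 16) /\
   is_design 3 (4 * n) 5 (3 * (n - 1) * (n - 2))
     (det_hypergraph (S - 1%:M) 5 (-16))) /\
  (is_design 3 (4 * n) 5 (5 * n * (n - 1))
     (det_hypergraph (S + 1%:M) 5 32) /\
   is_design 3 (4 * n) 5 (5 * n * (n - 1))
     (det_hypergraph (S - 1%:M) 5 (-32))).
Proof.
have n1 : (1 < n)%N by lia.
have [_ _ skewS _] := hS.
rewrite !det_hypergraph_sub1 //.
have d16 : is_design 3 (4 * n) 5 (3 * (n - 1) * (n - 2))
    (det_hypergraph (S + 1%:M) 5 16).
  by apply: det_hypergraph_design => T /(@quintuple_degree _ _ _ n1 hS)[].
have d32 : is_design 3 (4 * n) 5 (5 * n * (n - 1))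
    (det_hypergraph (S + 1%:M) 5 32).
  by apply: det_hypergraph_design => T /(@quintuple_degree _ _ _ n1 hS)[].
split; first by apply: det_hypergraph_design => T; apply: quad_degree_1.
by split; first by apply: det_hypergraph_design => T; apply: quad_degree_9.
Qed.
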